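(* Let $A\in\mathbb{C}^{n\times n}$ have index $k$, let $m$ be a positive integer, let $A_1=AA^{\mathrm{w}_m}A$, and let $X\in\mathbb{C}^{n\times n}$. Then the following statements are equivalent: (a) $X=A^{\mathrm{w}_m,\dagger}$; (b) $XA^{k+1}=A^k$, $r(X)=r(A^k)$ and $A^*AX=A^*A_1A^\dagger$; (c) $XA^{k+1}=A^k$, $r(X)=r(A^k)$ and $AX=A_1A^\dagger$; (d) $XA^{k+1}=A^k$, $r(X)=r(A^k)$ and $A^kX=A_1^kA^\dagger$.
   Context: $r(\cdot)$ and $(\cdot)^*$ denote rank and conjugate transpose; $A^\dagger$ is the Moore-Penrose inverse and $A^D$ the Drazin inverse. The index of $A\in\mathbb{C}^{n\times n}$ is the smallest nonnegative integer $k$ with $r(A^{k+1})=r(A^k)$ (zeroth powers of matrices are $I_n$). For $A$ of index $k$, the core-EP inverse is $A^{\mathrm{cEP}}=A^DA^k(A^k)^\dagger$ and the $m$-weak group inverse is $A^{\mathrm{w}_m}=(A^{\mathrm{cEP}})^{m+1}A^m$. The $m$-weak group MP inverse $A^{\mathrm{w}_m,\dagger}$ is the unique $Y\in\mathbb{C}^{n\times n}$ satisfying $YAY=Y$, $AY=A_1A^\dagger$ and $YA=A^DA_1$, where $A_1=AA^{\mathrm{w}_m}A$. *)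

(* Defs.v *)
From HB Require Import structures.
From mathcomp Require Import all_boot all_order all_algebra.
From mathcomp Require Import spectral complex.
From mathcomp Require Import boolp classical_sets reals.
Set Implicit Arguments.
Unset Strict Implicit.
Unset Printing Implicit Defensive.
Import Order.TTheory GRing.Theory Num.Theory.
Local Open Scope sesquilinear_scope.
Local Open Scope classical_set_scope.
Local Open Scope ring_scope.

Section GeneralizedInverses.
Variables (C : numClosedFieldType) (n : nat).
Implicit Types A X Y : 'M[C]_n.

Lemma rank_exp_stable A :
  exists k, \rank (A ^+ k.+1) == \rank (A ^+ k).
Proof.
have [//|H] := pselect (exists k, \rank (A ^+ k.+1) == \rank (A ^+ k)).
exfalso.
suff /(_ n.+1) : forall k, (\rank (A ^+ k) + k <= n)%N by rewrite addnS ltnNge leq_addl.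
elim=> [|k IH]; first by rewrite addn0 rank_leq_row.
apply: leq_trans IH; rewrite addnS -addSn leq_add2r ltn_neqAle.
apply/andP; split; first by apply/negP => Hk; apply: H; exists k.
by rewrite exprSr; apply: mxrankM_maxl.
Qed.

Definition mxindex A : nat := ex_minn (rank_exp_stable A).

(* The inverses below are defined as "the" matrix satisfying a system of
   equations: [xget 0 S] is an element of [S] if [S] is nonempty and [0]
   otherwise, so it is the unique element of [S] if there is exactly one. *)

Definition is_MP A X : Prop :=
  [/\ A *m X *m A = A, X *m A *m X = X,
      (A *m X)^t* = A *m X & (X *m A)^t* = X *m A].

Definition mpinv A : 'M[C]_n := xget 0 [set X | is_MP A X].

Definition is_Drazin A X : Prop :=
  [/\ X *m A ^+ (mxindex A).+1 = A ^+ mxindex A,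
      X *m A *m X = X & A *m X = X *m A].

Definition drazin A : 'M[C]_n := xget 0 [set X | is_Drazin A X].

Definition core_ep A : 'M[C]_n :=
  drazin A *m A ^+ mxindex A *m mpinv (A ^+ mxindex A).

Definition weak_group (m : nat) A : 'M[C]_n := core_ep A ^+ m.+1 *m A ^+ m.

Definition is_weak_groupMP (m : nat) A Y : Prop :=
  let A1 := A *m weak_group m A *m A in
  [/\ Y *m A *m Y = Y, A *m Y = A1 *m mpinv A & Y *m A = drazin A *m A1].

Definition weak_groupMP (m : nat) A : 'M[C]_n :=
  xget 0 [set Y | is_weak_groupMP m A Y].

End GeneralizedInverses.

(* Main.v *)
Require Import Defs.
From mathcomp Require Import classical_sets.
From mathcomp Require Import all_boot all_order all_algebra.
From mathcomp Require Import spectral complex reals.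
Import GRing.Theory Num.Theory.
Local Open Scope sesquilinear_scope.
Local Open Scope complex_scope.
Local Open Scope ring_scope.

(** Everything happens on the column space of [A ^+ k], on which [A] acts
    bijectively because [k] is the index.  The equation
    [Y *m A ^+ k.+1 = A ^+ k] says that [Y] inverts [A] there.  The Drazin
    inverse, the core-EP inverse and the [m]-weak group inverse [W] all do so,
    and [W] has its columns in that space.  These two properties of [W]
    ([weak_group_left_inverse], [weak_group_range]) are all that is used of it:
    they give [W *m A *m W = W], hence
    [weak_groupMP m A = W *m A *m mpinv A] ([weak_groupMPE]), from which (a)
    implies (b) is read off.

    The step from (b) to (c) cancels [A^t*], as [A^t* *m A *m Z = 0] forces
    [A *m Z = 0].  The matrix [A1 = A *m W *m A] has its columns in the column
    space of [A ^+ k] and agrees with [A] on it, so [A1 ^+ k] is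
    [A ^+ k.-1 *m A1] for [k > 0]; this turns (c) into (d).  In the other
    direction, [X *m A ^+ k.+1 = A ^+ k] together with the rank condition puts
    the columns of [X], hence those of [A *m X] and of [A1 *m mpinv A], in the
    column space of [A ^+ k], where [A ^+ k.-1] can be cancelled, so (d) gives
    (c).  At index [0], [W *m A = 1] and [A1 = A], so that (d) reads
    [X = mpinv A] and (c) reads [A *m X = A *m mpinv A], while the first
    condition is [X *m A = 1].  Finally (c) makes [X] an outer inverse of [A]
    with the products [A *m X] and [X *m A] that characterize
    [weak_groupMP m A].

    The Moore-Penrose and Drazin inverses are specified as solutions of systems
    of equations, so their existence has to be established first: by a full
    rank factorization for the former, and by factoring [A ^+ k] through
    [A ^+ k.+1] on both sides for the latter. *)

(** * Inverting an element on the range of one of its powers *)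

Section RingPowers.
Context {R : pzRingType}.
Implicit Types a d t w y z : R.

Lemma expr_left_cancel {a y k} j :
  y * a ^+ k.+1 = a ^+ k -> y ^+ j * a ^+ (k + j) = a ^+ k.
Proof.
move=> Hy; elim: j => [|j IH]; first by rewrite addn0 expr0 mul1r.
by rewrite exprSr addnS -addSn exprD mulrA -(mulrA _ y) Hy -mulrA -exprD.
Qed.

Lemma expr_right_cancel {a z k} j :
  a ^+ k.+1 * z = a ^+ k -> a ^+ (k + j) * z ^+ j = a ^+ k.
Proof.
move=> Hz; elim: j => [|j IH]; first by rewrite addn0 expr0 mulr1.
by rewrite exprS addnS -addSn addnC exprD mulrA -(mulrA _ _ z) Hz -exprD addnC.
Qed.

(** A left and a right inverse of [a] on the [k]-th power need not commute with
    [a], but they assemble into the Drazin inverse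
    [y ^+ k.+1 * a ^+ k = a ^+ k * z ^+ k.+1]. *)
Lemma drazin_of_left_right {a y z k} :
  y * a ^+ k.+1 = a ^+ k -> a ^+ k.+1 * z = a ^+ k ->
  exists d, [/\ d * a ^+ k.+1 = a ^+ k, d * a * d = d & a * d = d * a].
Proof.
move=> Hy Hz.
have Ly := expr_left_cancel k.+1 Hy; have Lz := expr_right_cancel k.+1 Hz.
have E : y ^+ k.+1 * a ^+ k = a ^+ k * z ^+ k.+1.
  by rewrite -{1}Lz mulrA Ly.
exists (y ^+ k.+1 * a ^+ k); split.
- by rewrite -mulrA -exprD.
- by rewrite {2}E -mulrA (mulrA a) -exprS mulrA -(mulrA _ (a ^+ k)) -exprD Ly.
(* Both products equal [y ^+ k.+1 * a ^+ (k + k.+1).+1 * z ^+ k.+1]. *)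
transitivity (y ^+ k.+1 * a ^+ (k + k.+1).+1 * z ^+ k.+1).
  by rewrite E mulrA -exprS [a ^+ (k + _).+1]exprSr mulrA Ly -exprSr.
by rewrite [a ^+ (k + _).+1]exprS -!mulrA Lz -exprS -exprSr.
Qed.

Lemma left_inverse_fix {a y k} z :
  y * a ^+ k.+1 = a ^+ k -> y * a * (a ^+ k * z) = a ^+ k * z.
Proof. by move=> Hy; rewrite mulrA -(mulrA y) -exprS Hy. Qed.

Lemma expr_mul_eq0_cancel {a y k} j z :
  y * a ^+ k.+1 = a ^+ k -> a ^+ j * (a ^+ k * z) = 0 -> a ^+ k * z = 0.
Proof.
move=> /(expr_left_cancel j) Hy.
by rewrite mulrA -exprD addnC => H; rewrite -Hy -mulrA H mulr0.
Qed.

(** If [w] has its range in that of [a ^+ k] and inverts [a] there, then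
    [b = a * w * a] agrees with [a] on its own range, so every factor of a
    power of [b] except the rightmost one can be replaced with [a]. *)
Lemma expr_mul_left_inverse {a w t k} j :
  w * a ^+ k.+1 = a ^+ k -> w = a ^+ k * t ->
  (a * w * a) ^+ j.+1 = a ^+ j * (a * w * a).
Proof.
move=> Hw Ht; elim: j => [|j IH]; first by rewrite expr1 expr0 mul1r.
have E : a ^+ j * (a * w * a) = a ^+ k * (a ^+ j.+1 * t * a).
  by rewrite Ht !mulrA -exprSr -!exprD addnC.
rewrite exprS IH exprS -(mulrA a w a) -!mulrA (mulrA a w a) (mulrA w a).
by rewrite E (left_inverse_fix _ Hw).
Qed.

End RingPowers.

(** * Rank factorizations *)

Section Rank.
Context {F : fieldType}.

Lemma rank_mulmxl_factor {m n p} {B : 'M[F]_(m, n)} {M : 'M_(n, p)} :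
  \rank (B *m M) = \rank M -> exists P, M = P *m (B *m M).
Proof.
by move=> /eqP H; apply/submxP; rewrite -(mxrank_leqif_sup (submxMl B M)).
Qed.

Lemma rank_mulmxr_factor {m n p} {B : 'M[F]_(m, n)} {M : 'M_(n, p)} :
  \rank (B *m M) = \rank B -> exists Q, B = B *m M *m Q.
Proof.
rewrite -mxrank_tr -(mxrank_tr B) trmx_mul => /rank_mulmxl_factor [P HP].
by exists P^T; rewrite -[LHS]trmxK HP !trmx_mul !trmxK.
Qed.

End Rank.

Section GeneralizedInverses.
Context {C : numClosedFieldType}.

(** * Conjugate transposes and the Moore-Penrose inverse *)

Lemma adjmxM {m n p} (B : 'M[C]_(m, n)) (M : 'M_(n, p)) :
  (B *m M)^t* = M^t* *m B^t*.
Proof. by rewrite trmx_mul map_mxM. Qed.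

(** The diagonal entries of [B *m B^t*] are sums of squared moduli of entries
    of [B]. *)
Lemma mulmx_adj_eq0 {m n} (B : 'M[C]_(m, n)) : B *m B^t* = 0 -> B = 0.
Proof.
move=> H; apply/matrixP=> i j; rewrite mxE.
have /matrixP /(_ i i) := H; rewrite !mxE => /eqP.
rewrite psumr_eq0 => [|l _]; last by rewrite !mxE mul_conjC_ge0.
by move=> /allP /(_ j (mem_index_enum _)); rewrite !mxE mul_conjC_eq0 => /eqP.
Qed.

(** Multiplying the hypothesis by the adjoint of [M] gives the Gram matrix of
    the adjoint of [B *m M]. *)
Lemma adj_mulmx_cancel {m n p} {B : 'M[C]_(m, n)} {M : 'M_(n, p)} :
  B^t* *m B *m M = 0 -> B *m M = 0.
Proof.
move=> H; rewrite -[LHS]trmxCK; suff -> : (B *m M)^t* = 0 by rewrite trmx0 map_mx0.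
by apply: mulmx_adj_eq0; rewrite trmxCK adjmxM -mulmxA (mulmxA _ B) H mulmx0.
Qed.

(** By [mulmx_adj_eq0] applied to [v *m B], a vector [v] killed by the Gram
    matrix is killed by [B]. *)
Lemma gram_unit {m n} (B : 'M[C]_(m, n)) : row_free B -> B *m B^t* \in unitmx.
Proof.
move=> freeB; rewrite -row_free_unit; apply: inj_row_free => v Hv.
apply/eqP; rewrite -(mulmx_free_eq0 v freeB); apply/eqP/mulmx_adj_eq0.
by rewrite adjmxM mulmxA -(mulmxA v) Hv mul0mx.
Qed.

Lemma invmx_adj {n} (B : 'M[C]_n) : (invmx B)^t* = invmx (B^t*).
Proof. by rewrite trmx_inv map_invmx. Qed.

(** Writing [F'], [G'] for the adjoints, the inverse is
    [G' *m (G *m G')^-1 *m (F' *m F)^-1 *m F'], where both Gram matrices are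
    invertible by [gram_unit]. *)
Lemma full_rank_factorization_MP {n r} (F : 'M[C]_(n, r)) (G : 'M_(r, n)) :
  row_free (F^t*) -> row_free G -> exists Y, is_MP (F *m G) Y.
Proof.
move=> /gram_unit; rewrite trmxCK => uF /gram_unit uG.
set P := invmx (G *m G^t*); set Q := invmx (F^t* *m F).
have hP : P^t* = P by rewrite invmx_adj adjmxM trmxCK.
have hQ : Q^t* = Q by rewrite invmx_adj adjmxM trmxCK.
pose Y := G^t* *m P *m Q *m F^t*.
have AY : F *m G *m Y = F *m Q *m F^t*.
  by rewrite /Y !mulmxA -(mulmxA F) -(mulmxA F) mulmxV // mulmx1.
have YA : Y *m (F *m G) = G^t* *m P *m G.
  by rewrite /Y !mulmxA -2!(mulmxA (_ *m P)) -(mulmxA Q) mulVmx // mulmx1.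
exists Y; split.
- by rewrite AY mulmxA -(mulmxA _ _ F) mulmxKV.
- by rewrite YA /Y !mulmxA -(mulmxA _ G) mulmxKV.
- by rewrite AY !adjmxM trmxCK hQ mulmxA.
by rewrite YA !adjmxM trmxCK hP mulmxA.
Qed.

Lemma mpinvP {n} (A : 'M[C]_n) : is_MP A (mpinv A).
Proof.
apply: xgetPex => /=; rewrite -{1}(mulmx_base A).
apply: full_rank_factorization_MP; last exact: row_base_free.
by rewrite /row_free mxrank_map mxrank_tr; apply: col_base_full.
Qed.

Context {n : nat}.
Implicit Types A X Y : 'M[C]_n.

Lemma mpinvK A : A *m mpinv A *m A = A.
Proof. by case: (mpinvP A). Qed.

Lemma mulmx_mpinvK p (Y : 'M[C]_(p, n)) A : Y *m A *m mpinv A *m A = Y *m A.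
Proof. by rewrite -!mulmxA (mulmxA A) mpinvK. Qed.

(** * The Drazin inverse and the weak group inverse *)

Lemma rank_mxindex A :
  \rank (A ^+ (mxindex A).+1) = \rank (A ^+ mxindex A).
Proof. by rewrite /mxindex; case: ex_minnP => k /eqP. Qed.

Lemma drazinP A : is_Drazin A (drazin A).
Proof.
apply: xgetPex => /=.
have [Y HY] : exists Y, A ^+ mxindex A = Y *m A ^+ (mxindex A).+1.
  by rewrite exprS; apply: rank_mulmxl_factor; rewrite mulmxE -exprS rank_mxindex.
have [Z HZ] : exists Z, A ^+ mxindex A = A ^+ (mxindex A).+1 *m Z.
  by rewrite exprSr; apply: rank_mulmxr_factor; rewrite mulmxE -exprSr rank_mxindex.
exact: drazin_of_left_right (esym HY) (esym HZ).
Qed.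

Lemma core_ep_range A :
  core_ep A = A ^+ mxindex A *m (drazin A *m mpinv (A ^+ mxindex A)).
Proof.
case: (drazinP A) => _ _ comm; rewrite /core_ep mulmxA; congr (_ *m _).
exact: (commrX _ (esym comm)).
Qed.

Lemma core_ep_left_inverse A :
  core_ep A *m A ^+ (mxindex A).+1 = A ^+ mxindex A.
Proof.
case: (drazinP A) => H _ _.
by rewrite [A ^+ _.+1]exprSr -mulmxE /core_ep mulmxA -!(mulmxA (drazin A))
  mpinvK mulmxE -exprSr.
Qed.

Lemma weak_group_range m A : exists T, weak_group m A = A ^+ mxindex A *m T.
Proof.
rewrite /weak_group exprS core_ep_range -mulmxE -!mulmxA.
by eexists; reflexivity.
Qed.

(** The core-EP inverse undoes one multiplication by [A], so its power
    [m.+1] undoes all but [k] of the [k + m.+1] factors. *)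
Lemma weak_group_left_inverse m A :
  weak_group m A *m A ^+ (mxindex A).+1 = A ^+ mxindex A.
Proof.
rewrite /weak_group mulmxE -mulrA -exprD addnS addnC -addnS.
exact: expr_left_cancel (core_ep_left_inverse A).
Qed.

(** * The weak group MP inverse in closed form *)

Lemma mul_weak_group_fix {m A k Y} (Z : 'M[C]_n) :
  k = mxindex A -> Y *m A ^+ k.+1 = A ^+ k ->
  Y *m A *m (weak_group m A *m Z) = weak_group m A *m Z.
Proof.
move=> -> HY; have [T ->] := weak_group_range m A.
by rewrite -(mulmxA _ T); apply: (left_inverse_fix (T *m Z) HY).
Qed.

(** The system determines [Y], as [Y = Y *m A *m Y] is a product of the two
    prescribed matrices [Y *m A] and [A *m Y]. *)
Lemma weak_groupMP_unique {m A X Y} :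
  is_weak_groupMP m A X -> is_weak_groupMP m A Y -> X = Y.
Proof.
move=> [X1 X2 X3] [Y1 Y2 Y3].
by rewrite -X1 X3 -Y3 -mulmxA X2 -Y2 mulmxA Y1.
Qed.

Lemma weak_groupMP_eqP {m A X} :
  is_weak_groupMP m A X -> X = weak_groupMP m A.
Proof.
by move=> HX; apply: (weak_groupMP_unique HX); apply: (xgetI _ HX).
Qed.

Lemma weak_groupMPE m A :
  weak_groupMP m A = weak_group m A *m A *m mpinv A.
Proof.
apply/esym/weak_groupMP_eqP.
have WY := weak_group_left_inverse m A; have [DY _ _] := drazinP A.
set W := weak_group m A.
split.
- by rewrite mulmx_mpinvK -(mulmxA W A (mpinv A)) (mul_weak_group_fix _ erefl WY).
- by rewrite !mulmxA.
rewrite mulmx_mpinvK -(mulmxA A W) (mulmxA (drazin A)).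
by rewrite (mul_weak_group_fix _ erefl DY).
Qed.

End GeneralizedInverses.

(** * The equivalence *)

Theorem theorem4p3 (R : realType) (n : nat) (A : 'M[R[i]]_n) (k m : nat)
    (A1 X : 'M[R[i]]_n) (hk : mxindex A = k) (hm : (0 < m)%N)
    (hA1 : A1 = A *m weak_group m A *m A) :
  [<-> X = weak_groupMP m A;
       [/\ X *m A ^+ k.+1 = A ^+ k, \rank X = \rank (A ^+ k)
         & A^t* *m A *m X = A^t* *m A1 *m mpinv A];
       [/\ X *m A ^+ k.+1 = A ^+ k, \rank X = \rank (A ^+ k)
         & A *m X = A1 *m mpinv A];
       [/\ X *m A ^+ k.+1 = A ^+ k, \rank X = \rank (A ^+ k)
         & A ^+ k *m X = A1 ^+ k *m mpinv A]].
Proof.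
have WA := weak_group_left_inverse m A.
have [T defW] := weak_group_range m A.
have [DA _ _] := drazinP A.
rewrite hk in WA defW DA.
have A1j j : A1 ^+ j.+1 = A ^+ j *m A1.
  by rewrite hA1; apply: expr_mul_left_inverse WA defW.
have A1k : A1 = A ^+ k *m (A *m T *m A).
  by rewrite hA1 defW !mulmxA mulmxE -exprS -exprSr.
have A1_index0 : k = 0%N -> A1 = A.
  by move=> k0; move: WA; rewrite k0 expr1 expr0 hA1 -mulmxA => ->; rewrite mulmx1.
tfae.
- have XA : weak_group m A *m A *m mpinv A *m A ^+ k.+1 = A ^+ k.
    by rewrite [A ^+ _.+1]exprS -mulmxE mulmxA mulmx_mpinvK -mulmxA mulmxE -exprS.
  move=> ->; rewrite weak_groupMPE; split=> //; last by rewrite hA1 !mulmxA.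
  apply/eqP; rewrite eqn_leq -{2}XA mxrankM_maxl andbT.
  by rewrite defW -!mulmxA mxrankM_maxl.
- move=> [XA rX H]; split=> //; apply/eqP; rewrite -subr_eq0; apply/eqP.
  have E : A *m X - A1 *m mpinv A = A *m (X - weak_group m A *m A *m mpinv A).
    by rewrite mulmxBr hA1 !mulmxA.
  by rewrite E; apply: adj_mulmx_cancel; rewrite -mulmxA -E mulmxBr !mulmxA H subrr.
- move=> [XA rX H]; split=> //; case Dk: k => [|j].
    (* At index 0, [X] is a left inverse of [A] and [A1 = A]. *)
    have XA1 : X *m A = 1%:M by rewrite -[A]expr1 -[1%N]/(0.+1)%N -Dk XA Dk.
    rewrite !expr0 !mul1mx -[LHS]mul1mx -[RHS]mul1mx -XA1 -!mulmxA H.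
    by rewrite A1_index0.
  by rewrite exprSr -mulmxE -mulmxA H A1j mulmxA.
move=> [XA rX H].
have [Z defX] : exists Z, X = A ^+ k *m Z.
  by rewrite -XA; apply: rank_mulmxr_factor; rewrite XA.
have AX : A *m X = A1 *m mpinv A.
  case Dk: k => [|j].
    by move: H; rewrite A1_index0 // Dk !expr0 !mul1mx => ->.
  have E : A *m X - A1 *m mpinv A = A ^+ k *m (A *m Z - A *m T *m A *m mpinv A).
    rewrite mulmxBr {1}defX {1}A1k !mulmxA; congr (_ *m _ - _).
    by rewrite mulmxE -exprS -exprSr.
  apply/eqP; rewrite -subr_eq0 E; apply/eqP.
  apply: (expr_mul_eq0_cancel j _ XA); rewrite -mulmxE -E.
  by rewrite mulmxBr !mulmxA -A1j -[A ^+ j *m A]exprSr -Dk H subrr.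
have XAX : X *m A *m X = X.
  by rewrite {2 3}defX; apply: (left_inverse_fix Z XA).
apply: weak_groupMP_eqP; split; rewrite -?hA1 //.
(* [X] and the Drazin inverse both invert [A] on the range of [weak_group m A]. *)
rewrite -{1}XAX -(mulmxA X A X) AX hA1 -(mulmxA X _ A) mulmx_mpinvK.
rewrite -(mulmxA A (weak_group m A)) (mulmxA X) (mulmxA (drazin A)).
by rewrite !(mul_weak_group_fix _ (esym hk)).
Qed.
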